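(* Let $\mathcal G$ be a compact finite metric graph with Dirichlet vertex set $\mathsf V_{\mathrm D}$ satisfying the standing assumption of the context, let $\mathsf V_0\subset\mathsf V_{\mathrm N}$, and let $m\in\mathbb N$. Let $\mathcal G^{(m)}(\mathsf V_0)$ be the $m$-fold mirrored metric graph with respect to $\mathsf V_0$ and let $(\mathsf V_{\mathrm D})^{(m)}$ be the set of all $m$ copies of the elements of $\mathsf V_{\mathrm D}$ in it. Then $$\mathcal Q_t\big(\mathcal G^{(m)}(\mathsf V_0);(\mathsf V_{\mathrm D})^{(m)}\big)=m\,\mathcal Q_t(\mathcal G;\mathsf V_{\mathrm D})\qquad\text{for all }t>0.$$
   Context: Metric graph: $\mathcal G$ is obtained from a finite set $\mathsf E$ of edges, each $e\in\mathsf E$ identified with an interval $[0,\ell_e]$, $0<\ell_e<\infty$, by gluing endpoints at a finite set $\mathsf V$ of vertices (loops and multiple edges allowed). $\deg(v)$ is the number of edge ends at $v$ (a loop counts twice). Standing assumption on $\mathcal G$: $\mathcal G$ has no vertices of degree 2 (they are removed by merging the two incident edges); $\emptyset\ne\mathsf V_{\mathrm D}\subset\{v\in\mathsf V:\deg(v)=1\}$; $\mathcal G\setminus\mathsf V_{\mathrm D}$ is connected. $\mathsf V_{\mathrm N}=\mathsf V\setminus\mathsf V_{\mathrm D}$. Heat content (for any compact finite metric graph and any set $\mathsf V_{\mathrm D}$ of vertices): $\Delta^{\mathcal G;\mathsf V_{\mathrm D}}$ is the Laplacian on $L^2(\mathcal G)=\bigoplus_e L^2(0,\ell_e)$ with Dirichlet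 conditions on $\mathsf V_{\mathrm D}$ and continuity and Kirchhoff conditions on the other vertices, i.e. $-\Delta^{\mathcal G;\mathsf V_{\mathrm D}}$ is the self-adjoint operator associated with the form $a(u)=\int_{\mathcal G}|u'|^2\,dx$ on $H^1_0(\mathcal G;\mathsf V_{\mathrm D})=\{u\in\bigoplus_e H^1(0,\ell_e): u$ continuous at every vertex, $u(v)=0$ for $v\in\mathsf V_{\mathrm D}\}$. $p_t^{\mathcal G;\mathsf V_{\mathrm D}}(x,y)$ is the integral kernel of $e^{t\Delta^{\mathcal G;\mathsf V_{\mathrm D}}}$ and $\mathcal Q_t(\mathcal G;\mathsf V_{\mathrm D})=\int_{\mathcal G}\int_{\mathcal G}p_t^{\mathcal G;\mathsf V_{\mathrm D}}(x,y)\,dx\,dy$, $t>0$. Mirroring: take the disjoint union of $m$ copies $\mathcal G_1,\dots,\mathcal G_m$ of $\mathcal G$; each $v\in\mathsf V_0$ has copies $v^{(1)},\dots,v^{(m)}$. For each $v\in\mathsf V_0$ glue $v^{(1)},\dots,v^{(m)}$ to one new vertex $\widetilde v$. The resulting metric graph is the $m$-fold mirrored graph $\mathcal G^{(m)}(\mathsf V_0)$. For $\mathsf W\subset\mathsf V\setminus\mathsf V_0$, $\mathsf W^{(m)}$ denotes the set of the $m$ copies of all elements of $\mathsf W$ in $\mathcal G^{(m)}(\mathsf V_0)$. *)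

(* Defs.v *)
From HB Require Import structures.
From mathcomp Require Import all_boot all_order all_algebra.
From mathcomp Require Import all_classical all_reals all_analysis.
Set Implicit Arguments.
Unset Strict Implicit.
Unset Printing Implicit Defensive.
Import Order.TTheory GRing.Theory Num.Theory.
Import numFieldNormedType.Exports.
Local Open Scope classical_set_scope.
Local Open Scope ring_scope.

(* Edge e is the interval [0, len e]; its end 0 is glued to org e and its end
   len e to term e. *)
Record metricGraph (R : realType) := MetricGraph {
  vertex : finType;
  edge : finType;
  org : edge -> vertex;
  term : edge -> vertex;
  len : edge -> R;
  len_gt0 : forall e, 0 < len e }.

Definition degree (R : realType) (G : metricGraph R) (v : vertex G) : nat :=
  (#|[pred e : edge G | org e == v]| + #|[pred e : edge G | term e == v]|)%N.

(* The points of G: the vertices and the interior points of the edges. *)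
Definition graph_point (R : realType) (G : metricGraph R) : Type :=
  (vertex G + {p : edge G * R | 0 < p.2 < len p.1})%type.

Definition graph_pt (R : realType) (G : metricGraph R) (e : edge G) (x : R) :
    graph_point G :=
  if insub (e, x) is Some p then inr p
  else if x <= 0 then inl (org e) else inl (term e).

(* The quotient topology of the disjoint union of the intervals [0, len e]. *)
Definition graph_open (R : realType) (G : metricGraph R) :
    set (set (graph_point G)) :=
  [set U | forall e : edge G,
    open (graph_pt e @^-1` U : set (subspace `[0, len e]))].

Section graph_topology.
Variables (R : realType) (G : metricGraph R).

Let graph_openT : graph_open [set: graph_point G].
Proof. by move=> e; rewrite preimage_setT; exact: openT. Qed.

Let graph_openI : setI_closed (@graph_open R G).
Proof. by move=> A B oA oB e; rewrite preimage_setI; exact: openI. Qed.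

Let graph_open_bigU (I : Type) (f : I -> set (graph_point G)) :
  (forall i, graph_open (f i)) -> graph_open (\bigcup_i f i).
Proof.
by move=> of_ e; rewrite preimage_bigcup; apply: bigcup_open => i _; exact: of_.
Qed.

HB.instance Definition _ := Choice.on (graph_point G).
HB.instance Definition _ := isOpenTopological.Build (graph_point G)
  graph_openT graph_openI graph_open_bigU.

End graph_topology.

(* An isolated element of vertex G would be a clopen point of graph_point G, so
   sa_connected (with sa_deg1) also makes every vertex an endpoint of an edge. *)
Record standing_assumption (R : realType) (G : metricGraph R)
    (VD : {set vertex G}) : Prop := StandingAssumption {
  sa_no_degree2 : forall v : vertex G, degree v <> 2%N;
  sa_nonempty : exists v, v \in VD;
  sa_deg1 : forall v, v \in VD -> degree v = 1%N;
  sa_connected :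
    connected (~` [set inl v | v in [set` VD]] : set (graph_point G)) }.

(* Real-valued functions on G, given edge by edge; only the values on
   `]0, len e[ (on `[0, len e] for Sobolev functions) matter. *)
Definition gfun (R : realType) (G : metricGraph R) : Type := edge G -> R -> R.

Section heat_content.
Variables (R : realType) (G : metricGraph R).
Implicit Types (VD : {set vertex G}) (f g u v : gfun G).

Local Notation mu := (@lebesgue_measure R).

Definition gint f : R := \sum_(e : edge G) \int[mu]_(x in `]0, len e[) f e x.

Definition L2 f : Prop :=
  forall e, (f e \_ `]0, len e[%classic) \in Lfun mu 2%:E.

Definition gae_eq f g : Prop :=
  forall e, f e = g e %[ae mu in `]0, len e[%classic].

Definition L2inner f g : R := gint (fun e x => f e x * g e x).

Definition L2norm f : R := Num.sqrt (L2inner f f).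

Definition test_function (l : R) (phi : R -> R) : Prop :=
  [/\ forall x, derivable phi x 1,
      continuous (derive1 phi)
    & closure [set x | phi x != 0] `<=` `]0, l[ ].

Definition weak_derivative (l : R) (w w' : R -> R) : Prop :=
  forall phi, test_function l phi ->
    \int[mu]_(x in `]0, l[) (w x * derive1 phi x) =
    - \int[mu]_(x in `]0, l[) (w' x * phi x).

(* u is the continuous representative of an element of H^1_0(G; VD), and du is
   its weak derivative; c z is the common value of u at the edge ends glued
   to z. *)
Record H10 VD u du : Prop := InH10 {
  H10_L2 : L2 u;
  H10_dL2 : L2 du;
  H10_weak : forall e, weak_derivative (len e) (u e) (du e);
  H10_continuous : forall e, {within `[0, len e], continuous (u e)};
  H10_vertex : exists c : vertex G -> R,
    [/\ forall e, u e 0 = c (org e),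
        forall e, u e (len e) = c (term e)
      & forall z, z \in VD -> c z = 0] }.

(* f is in the domain of the Laplacian and its image is g: the operator associated
   with the form a(u, v) = \int u' v' on H^1_0(G; VD) maps f to -g. *)
Definition laplacian VD f g : Prop :=
  [/\ L2 f, L2 g &
      exists u du, [/\ H10 VD u du, gae_eq f u &
        forall v dv, H10 VD v dv -> L2inner du dv = - L2inner g v]].

(* T is exp(t Delta): the strongly continuous semigroup of bounded operators on
   L^2(G) whose infinitesimal generator is the Laplacian.  Operators act on
   representatives of elements of L^2(G); linearity and boundedness make them respect gae_eq. *)
Record heat_semigroup VD (T : R -> gfun G -> gfun G) : Prop := HeatSemigroup {
  hs_L2 : forall (t : R) f, 0 <= t -> L2 f -> L2 (T t f);
  hs_linear : forall (t a : R) f g, 0 <= t -> L2 f -> L2 g ->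
    gae_eq (T t (fun e x => a * f e x + g e x))
           (fun e x => a * T t f e x + T t g e x);
  hs_bounded : forall t : R, 0 <= t ->
    exists C : R, forall f, L2 f -> L2norm (T t f) <= C * L2norm f;
  hs_0 : forall f, L2 f -> gae_eq (T 0 f) f;
  hs_D : forall (s t : R) f, 0 <= s -> 0 <= t -> L2 f ->
    gae_eq (T (s + t) f) (T s (T t f));
  hs_continuous : forall f (t : R), L2 f -> 0 <= t ->
    L2norm (fun e x => T s f e x - T t f e x)
      @[s --> within [set s | 0 <= s] (nbhs t)] --> (0 : R);
  hs_generator : forall f g, L2 f -> L2 g ->
    (laplacian VD f g <->
     L2norm (fun e x => h^-1 * (T h f e x - f e x) - g e x)
       @[h --> (0 : R)^'+] --> (0 : R)) }.

(* p e x e' y is the value of the kernel at the point x of the edge e and the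
   point y of the edge e'. *)
Definition integral_kernel (S : gfun G -> gfun G)
    (p : edge G -> R -> edge G -> R -> R) : Prop :=
  (forall e e', measurable_fun (`]0, len e[%classic `*` `]0, len e'[%classic)
     (fun z : R * R => p e z.1 e' z.2)) /\
  (forall f, L2 f -> forall e, \forall x \ae mu, `]0, len e[%classic x ->
     (forall e', mu.-integrable `]0, len e'[
        (fun y => (p e x e' y * f e' y)%:E)) /\
     S f e x = gint (fun e' y => p e x e' y * f e' y)).

Definition heat_kernel VD (p : R -> edge G -> R -> edge G -> R -> R) : Prop :=
  exists2 T, heat_semigroup VD T & forall t, 0 < t -> integral_kernel (T t) (p t).

Definition heat_content (p : R -> edge G -> R -> edge G -> R -> R) (t : R) : R :=
  gint (fun e x => gint (fun e' y => p t e x e' y)).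

End heat_content.

Section mirroring.
Variables (R : realType) (G : metricGraph R) (V0 : {set vertex G}) (m : nat).

(* inl v is the single vertex obtained from the m copies of v \in V0, and
   inr (v, i) is the i-th copy of v \notin V0. *)
Definition mirror_vertex : Type :=
  ({v : vertex G | v \in V0} + {v : vertex G | v \notin V0} * 'I_m)%type.

HB.instance Definition _ := Finite.on mirror_vertex.

Definition mirror_copy (i : 'I_m) (v : vertex G) : mirror_vertex :=
  match @boolP (v \in V0) with
  | AltTrue v_in => inl (exist _ v v_in)
  | AltFalse v_notin => inr (exist _ v v_notin, i)
  end.

Definition mirror : metricGraph R := @MetricGraph R
  mirror_vertex
  (edge G * 'I_m)%type
  (fun e => mirror_copy e.2 (org e.1))
  (fun e => mirror_copy e.2 (term e.1))
  (fun e => len e.1)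
  (fun e => len_gt0 e.1).

Definition mirror_set (W : {set vertex G}) : {set vertex mirror} :=
  [set mirror_copy i v | i in 'I_m, v in W]%SET.

End mirroring.

(* Main.v *)
Require Import Defs.
From mathcomp Require Import all_boot all_order all_algebra.
From mathcomp Require Import all_classical all_reals all_analysis.
From mathcomp Require Import measurable_realfun.
From mathcomp Require Import ring lra.
Import Order.TTheory GRing.Theory Num.Theory.
Import numFieldNormedType.Exports.
Local Open Scope ring_scope.
Local Open Scope classical_set_scope.
Set Implicit Arguments.
Unset Strict Implicit.
Unset Printing Implicit Defensive.

(** The constant function 1 on the mirrored graph is the lift of the constant
function 1 on G, where the lift of f repeats f on each of the m sheets.  The
heat content is the integral of exp(t Delta) 1, so the theorem follows once the
two heat semigroups are intertwined by the lift at the function 1: the integral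
over the mirrored graph of a lifted function is m times the integral over G.

The lift maps the domain of the Laplacian of G into that of the mirrored graph
and commutes with the two operators ([laplacian_lift]).  Continuity and the
Dirichlet conditions lift along the folding map, and the weak equation is checked
one sheet at a time: a test function of the mirrored graph restricts on every
sheet to a test function of G ([H10_sheet]), because gluing copies of a vertex
only adds constraints.  The Kirchhoff condition at a glued vertex is thereby never
looked at.

Consequently, for f in the domain, the lift of the orbit of f solves the heat
equation on the mirrored graph, and so does the orbit of the lift of f.  Two
solutions with the same initial value agree ([heat_solution_unique]): the squared
norm of their difference w has the right derivative 2 <Delta w, w> = - 2 |w'|^2,
which is nonpositive.

The function 1 is not in the domain, since it violates the Dirichlet condition.
It is however the L^2 limit of twice continuously differentiable functions
supported away from all vertices ([cutoff]), which belong to the domain whatever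
the vertex conditions are ([laplacian_C2]); boundedness of the two semigroups
carries the identity over to the limit ([heat_semigroup_lift]). *)

(** * Square integrable functions on an interval *)

Section square_integrable.
Variables (R : realType) (l : R).
Implicit Types w v : R -> R.
Local Notation mu := (@lebesgue_measure R).
Local Notation D := (`]0, l[%classic : set R).

(** The condition that [L2] imposes on an edge of length [l]. *)
Definition square_integrable w := (w \_ D) \in Lfun mu 2%:E.

Lemma square_integrable_measurable w :
  square_integrable w -> measurable_fun D w.
Proof.
rewrite /square_integrable inE => /andP[/[!inE]/= mw _].
by apply/(@measurable_restrictT _ _ _ _ D w) => //; exact: measurable_itv.
Qed.

Lemma square_integrable_lin (a b : R) w v :
  square_integrable w -> square_integrable v ->
  square_integrable (fun x => a * w x + b * v x).
Proof.
rewrite /square_integrable => iw iv.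
have -> : (fun x => a * w x + b * v x) \_ D =
    (a \o* (w \_ D)) \+ (b \o* (v \_ D)).
  apply/funext => x /=; rewrite !patchE.
  by case: ifP => _; rewrite ?mulr0 ?mul0r ?addr0 // (mulrC a) (mulrC b).
have h1 : (1 <= 2%:E :> \bar R)%E by rewrite lee_fin ler1n.
have := @rpredD _ (Lfun mu 2%:E).
by apply; apply: Lfun_scale; rewrite ?ler1n.
Qed.

Lemma square_integrable_mul w v :
  square_integrable w -> square_integrable v ->
  mu.-integrable D (EFin \o (fun x => w x * v x)).
Proof.
move=> iw iv; have := Lfun2_mul_Lfun1 iw iv.
move/Lfun1_integrable => h.
apply/(integrable_mkcond _); first exact: measurable_itv.
apply: eq_integrable h => // x _ /=; rewrite !patchE.
by case: ifP => _ //=; rewrite mulr0.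
Qed.

Lemma square_integrable_bounded w (K : R) : measurable_fun D w ->
  (forall x, D x -> `|w x| <= K) -> square_integrable w.
Proof.
move=> mw bw; rewrite /square_integrable inE; apply/andP; split; rewrite inE/=.
  by apply/(@measurable_restrictT _ _ _ _ D w) => //; exact: measurable_itv.
rewrite /finite_norm unlock poweR_lty//.
apply: (@le_lt_trans _ _ (\int[mu]_x (((cst (`|K| `^ 2)) \_ D) x)%:E)%E).
  apply: ge0_le_integral => //.
  - by move=> x _ /=; rewrite lee_fin powR_ge0.
  - apply: (measurableT_comp (measurable_poweR _)) => //.
    apply: measurableT_comp => //; apply/measurable_EFinP.
    by apply/(@measurable_restrictT _ _ _ _ D w) => //; exact: measurable_itv.
  - apply/measurable_EFinP.
    by apply/(@measurable_restrictT _ _ _ _ D (cst (`|K| `^ 2)));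
      [exact: measurable_itv|exact: measurable_cst].
  - move=> x _ /=; rewrite lee_fin !patchE; case: ifP => [/set_mem Dx|_].
      by rewrite ge0_ler_powR ?nnegrE ?ler0n// (le_trans (bw _ Dx)) ?ler_norm.
    by rewrite normr0 powR0 ?pnatr_eq0.
apply: integrable_lty => //.
change (mu.-integrable setT (EFin \o ((cst (`|K| `^ 2)) \_ D))).
rewrite -restrict_EFin; apply: (integrable_mkcond _ _).1.
  exact: measurable_itv.
apply: measurable_bounded_integrable => //; last exact: bounded_cst.
by rewrite /= lebesgue_measure_itv/=; case: ifPn => // _; rewrite -EFinB ltry.
Qed.

Lemma square_integrable_continuous w :
  {within `[0, l], continuous w} -> square_integrable w.
Proof.
move=> cw.
have [l0|l0] := leP l 0.
  apply: (@square_integrable_bounded w 0) => [|x].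
    by rewrite set_itv_ge ?bnd_simp -?leNgt//; exact: measurable_fun_set0.
  by rewrite set_itv_ge ?bnd_simp -?leNgt.
have sD : D `<=` `[0, l] by apply: subset_itv; rewrite bnd_simp.
have /compact_bounded[M [_ /(_ (M + 1)) bM]] :=
  continuous_compact cw (@segment_compact _ 0 l).
apply: (@square_integrable_bounded w (M + 1)).
  apply: measurable_funS (subspace_continuous_measurable_fun _ cw) => //.
by move=> x Dx; apply: bM; [rewrite ltrDl|exists x => //; exact: sD].
Qed.

End square_integrable.

(** * The inner product of L^2(G) *)

(** Monotonicity of the almost everywhere filter, with the measure fixed: the
filter instance is otherwise not inferred once the measurable structures of the
real line have been unfolded. *)
Lemma ae_imply1 (R : realType) (P Q : R -> Prop) : (forall x, P x -> Q x) ->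
  (\forall x \ae @lebesgue_measure R, P x) ->
  \forall x \ae @lebesgue_measure R, Q x.
Proof.
move=> PQ h.
by apply: (@filterS _ _ (ae_filter_ringOfSetsType lebesgue_measure)) h.
Qed.

Lemma ae_imply2 (R : realType) (P P' Q : R -> Prop) :
  (forall x, P x -> P' x -> Q x) ->
  (\forall x \ae @lebesgue_measure R, P x) ->
  (\forall x \ae @lebesgue_measure R, P' x) ->
  \forall x \ae @lebesgue_measure R, Q x.
Proof.
move=> PQ h h'.
by apply: (@filterS2 _ _ (ae_filter_ringOfSetsType lebesgue_measure)) h h'.
Qed.

Section L2_theory.
Variables (R : realType) (G : metricGraph R).
Implicit Types f g h : gfun G.
Local Notation mu := (@lebesgue_measure R).

Lemma Rintegral_ae_eq (D : set R) (w v : R -> R) : measurable D ->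
  measurable_fun D w -> measurable_fun D v -> w = v %[ae mu in D] ->
  \int[mu]_(x in D) w x = \int[mu]_(x in D) v x.
Proof.
move=> mD mw mv wv; rewrite /Rintegral; congr fine.
apply: ae_eq_integral => //; [exact/measurable_EFinP|exact/measurable_EFinP|].
by apply: ae_imply1 wv => x h Dx /=; rewrite h.
Qed.

(** Sums, differences and difference quotients of functions on the graph are all
rewritten into this form, so that one bilinearity lemma serves them all. *)
Definition glin (a : R) f (b : R) g : gfun G := fun e x => a * f e x + b * g e x.

Lemma L2_glin a b f g : L2 f -> L2 g -> L2 (glin a f b g).
Proof. by move=> f2 g2 e; apply: square_integrable_lin; [exact: f2|exact: g2]. Qed.

Lemma L2_mul f g e : L2 f -> L2 g ->
  mu.-integrable `]0, len e[%classic (EFin \o (fun x => f e x * g e x)).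
Proof. by move=> f2 g2; apply: square_integrable_mul; [exact: f2|exact: g2]. Qed.

Lemma L2_measurable f e : L2 f -> measurable_fun `]0, len e[%classic (f e).
Proof. by move=> f2; apply: square_integrable_measurable; exact: f2. Qed.

Lemma L2innerC f g : L2inner f g = L2inner g f.
Proof.
apply: eq_bigr => e _; apply: eq_Rintegral => x _; exact: mulrC.
Qed.

Lemma L2inner_glin a b f g h : L2 f -> L2 g -> L2 h ->
  L2inner (glin a f b g) h = a * L2inner f h + b * L2inner g h.
Proof.
move=> f2 g2 h2; rewrite /L2inner /gint !mulr_sumr -big_split/=.
apply: eq_bigr => e _.
have iZ k := @integrableZl _ _ _ mu _ (measurable_itv _) k _ (L2_mul e _ h2).
rewrite -!RintegralZl//; try exact: L2_mul.
rewrite -RintegralD//.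
- by apply: eq_Rintegral => x _; rewrite /glin mulrDl !mulrA.
- exact: iZ.
- exact: iZ.
Qed.

Lemma L2inner_glinr a b f g h : L2 f -> L2 g -> L2 h ->
  L2inner h (glin a f b g) = a * L2inner h f + b * L2inner h g.
Proof. by move=> f2 g2 h2; rewrite !(L2innerC h) L2inner_glin. Qed.

Lemma L2inner_ge0 f : 0 <= L2inner f f.
Proof.
apply: sumr_ge0 => e _; apply: Rintegral_ge0 => x _.
by rewrite -expr2 sqr_ge0.
Qed.

Lemma L2norm_ge0 f : 0 <= L2norm f.
Proof. exact: sqrtr_ge0. Qed.

Lemma L2norm_sqr f : L2norm f ^+ 2 = L2inner f f.
Proof. by rewrite sqr_sqrtr// L2inner_ge0. Qed.

(** The polynomial a |-> |f + a g|^2 is nonnegative.  On representatives the inner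
product is only semidefinite, hence the separate case |g| = 0. *)
Lemma L2inner_CauchySchwarz f g : L2 f -> L2 g ->
  `|L2inner f g| <= L2norm f * L2norm g.
Proof.
move=> f2 g2.
set A := L2inner f f; set B := L2inner f g; set C := L2inner g g.
have A0 : 0 <= A := L2inner_ge0 f; have C0 : 0 <= C := L2inner_ge0 g.
have q a : 0 <= A + a * B *+ 2 + a ^+ 2 * C.
  have := L2inner_ge0 (glin 1 f a g).
  rewrite L2inner_glin ?L2inner_glinr//; try exact: L2_glin.
  by rewrite (L2innerC g f) -/A -/B -/C; congr (0 <= _); ring.
rewrite -ler_sqr ?nnegrE ?mulr_ge0 ?L2norm_ge0//.
rewrite exprMn !L2norm_sqr -/A -/C real_normK ?num_real//.
have [C_eq0|Cn0] := eqVneq C 0.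
  have [->|B0] := eqVneq B 0; first by rewrite expr0n/= mulr_ge0.
  (* for this a the polynomial, affine when C = 0, takes the value -1 *)
  have := q (- (A + 1) / (2 * B)); rewrite C_eq0.
  have -> : A + (- (A + 1) / (2 * B)) * B *+ 2 +
    (- (A + 1) / (2 * B)) ^+ 2 * 0 = -1 by field.
  by rewrite oppr_ge0 ler10.
have Cp : 0 < C by rewrite lt_def Cn0.
(* the minimiser of the polynomial *)
have := q (- B / C).
have -> : A + - B / C * B *+ 2 + (- B / C) ^+ 2 * C = (A * C - B ^+ 2) / C.
  by field.
by rewrite ler_pdivlMr// mul0r subr_ge0.
Qed.

Lemma L2norm_glin_le a b f g : L2 f -> L2 g ->
  L2norm (glin a f b g) <= `|a| * L2norm f + `|b| * L2norm g.
Proof.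
move=> f2 g2.
have nf := L2norm_ge0 f; have ng := L2norm_ge0 g.
rewrite -ler_sqr ?nnegrE ?addr_ge0 ?mulr_ge0 ?L2norm_ge0//.
rewrite L2norm_sqr L2inner_glin ?L2inner_glinr//; try exact: L2_glin.
rewrite (L2innerC g f) -!L2norm_sqr.
have := L2inner_CauchySchwarz f2 g2; set B := L2inner f g => hB.
have : a * b * B <= `|a| * `|b| * (L2norm f * L2norm g).
  rewrite (le_trans (ler_norm _))// normrM normrM.
  by apply: ler_wpM2l => //; apply: mulr_ge0.
have : `|a| ^+ 2 = a ^+ 2 by rewrite real_normK ?num_real.
have : `|b| ^+ 2 = b ^+ 2 by rewrite real_normK ?num_real.
rewrite sqrrD !exprMn => -> -> h; nra.
Qed.

Lemma gae_L2inner f f' g : L2 f -> L2 f' -> L2 g ->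
  gae_eq f f' -> L2inner f g = L2inner f' g.
Proof.
move=> f2 f'2 g2 ff'; apply: eq_bigr => e _; apply: Rintegral_ae_eq => //.
- by apply: measurable_funM; apply: L2_measurable.
- by apply: measurable_funM; apply: L2_measurable.
- by apply: ae_imply1 (ff' e) => x h Dx /=; rewrite h.
Qed.

Lemma gae_L2norm f f' : L2 f -> L2 f' -> gae_eq f f' -> L2norm f = L2norm f'.
Proof.
move=> f2 f'2 ff'; rewrite /L2norm; congr Num.sqrt.
by rewrite (gae_L2inner _ _ _ ff')// L2innerC (gae_L2inner _ _ _ ff').
Qed.

Lemma L2norm_eq0 f : L2 f -> L2norm f = 0 -> gae_eq f (fun _ _ => 0).
Proof.
move=> f2 f0 e.
have : L2inner f f = 0 by rewrite -L2norm_sqr f0 expr0n.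
rewrite /L2inner /gint => /eqP; rewrite psumr_eq0; last first.
  by move=> e' _; apply: Rintegral_ge0 => x _; rewrite -expr2 sqr_ge0.
move=> /allP /(_ e); rewrite mem_index_enum => /(_ isT)/= /eqP.
have ff := L2_mul e f2 f2.
have I0 : (\int[mu]_(x in `]0%R, len e[) `|(f e x * f e x)%:E| =
           \int[mu]_(x in `]0%R, len e[) (f e x * f e x)%:E)%E.
  by apply: eq_integral => x _; rewrite abse_EFin ger0_norm// -expr2 sqr_ge0.
rewrite /Rintegral => fI0.
have : (\int[mu]_(x in `]0%R, len e[) `|(f e x * f e x)%:E| = 0)%E.
  by rewrite I0 -[LHS]fineK ?fI0//; exact: integrable_fin_num.
move/ae_eq_integral_abs => /(_ (measurable_itv _)).
move=> /(_ (measurable_int _ ff)).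
apply: ae_imply1 => x h Dx; have := h Dx; rewrite /cst/= => -[] /eqP.
by rewrite mulf_eq0 orbb => /eqP.
Qed.

Lemma gae_eq_of_L2norm f g : L2 f -> L2 g ->
  L2norm (fun e x => f e x - g e x) = 0 -> gae_eq f g.
Proof.
move=> f2 g2 h.
have E : (fun e x => f e x - g e x) = glin 1 f (-1) g :> gfun G.
  by apply/funext => e; apply/funext => x; rewrite /glin; ring.
have := L2norm_eq0 _ h; rewrite {1}E => /(_ (L2_glin _ _ f2 g2)) {}h e.
by apply: ae_imply1 (h e) => x hx Dx; apply/eqP; rewrite -subr_eq0 hx.
Qed.

End L2_theory.

(** * Linearity and dissipativity of the Laplacian *)

Section laplacian_theory.
Variables (R : realType) (G : metricGraph R) (VD : {set vertex G}).
Implicit Types f g u du v dv : gfun G.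
Local Notation mu := (@lebesgue_measure R).

Lemma gae_eq_sym f g : gae_eq f g -> gae_eq g f.
Proof. by move=> fg e; apply: ae_imply1 (fg e) => x h Dx; rewrite h. Qed.

Lemma gae_eq_trans f g h : gae_eq f g -> gae_eq g h -> gae_eq f h.
Proof.
by move=> fg gh e; apply: ae_imply2 (fg e) (gh e) => x a b Dx; rewrite a// b.
Qed.

Lemma gae_eq_glin a b f f' g g' : gae_eq f f' -> gae_eq g g' ->
  gae_eq (glin a f b g) (glin a f' b g').
Proof.
move=> ff' gg' e; apply: ae_imply2 (ff' e) (gg' e) => x h h' Dx.
by rewrite /glin h// h'.
Qed.

Lemma test_function_square_integrable (l : R) (phi : R -> R) :
  test_function l phi ->
  square_integrable l phi /\ square_integrable l (derive1 phi).
Proof.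
move=> [dphi cphi _]; split; apply: square_integrable_continuous.
  apply: continuous_subspaceT => x; apply: differentiable_continuous.
  exact/derivable1_diffP.
exact: continuous_subspaceT.
Qed.

Lemma weak_derivative_lin (l a b : R) (w w' v v' : R -> R) :
  square_integrable l w -> square_integrable l w' ->
  square_integrable l v -> square_integrable l v' ->
  weak_derivative l w w' -> weak_derivative l v v' ->
  weak_derivative l (fun x => a * w x + b * v x) (fun x => a * w' x + b * v' x).
Proof.
move=> w2 w'2 v2 v'2 ww vv phi tphi.
have [phi2 dphi2] := test_function_square_integrable tphi.
have lin (p q r : R -> R) : square_integrable l p -> square_integrable l q ->
    square_integrable l r ->
    \int[mu]_(x in `]0, l[) ((a * p x + b * q x) * r x) =
    a * \int[mu]_(x in `]0, l[) (p x * r x) +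
    b * \int[mu]_(x in `]0, l[) (q x * r x).
  move=> p2 q2 r2.
  have ipr := square_integrable_mul p2 r2; have iqr := square_integrable_mul q2 r2.
  rewrite -!RintegralZl// -RintegralD//.
  - by apply: eq_Rintegral => x _; rewrite mulrDl !mulrA.
  - exact: (@integrableZl _ _ _ mu _ (measurable_itv _) a _ ipr).
  - exact: (@integrableZl _ _ _ mu _ (measurable_itv _) b _ iqr).
by rewrite !lin// ww// vv// !mulrN opprD.
Qed.

Lemma H10_glin a b u du v dv : H10 VD u du -> H10 VD v dv ->
  H10 VD (glin a u b v) (glin a du b dv).
Proof.
move=> [u2 du2 wu cu [c [c0 c1 cD]]] [v2 dv2 wv cv [d [d0 d1 dD]]]; split.
- exact: L2_glin.
- exact: L2_glin.
- by move=> e; apply: weak_derivative_lin; [exact: u2|exact: du2|exact: v2|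
    exact: dv2|exact: wu|exact: wv].
- move=> e x; apply: cvgD; apply: cvgM; [exact: cvg_cst|exact: cu|
    exact: cvg_cst|exact: cv].
- exists (fun z => a * c z + b * d z); split.
  + by move=> e; rewrite /glin c0 d0.
  + by move=> e; rewrite /glin c1 d1.
  + by move=> z zD; rewrite cD// dD// !mulr0 addr0.
Qed.

Lemma laplacian_glin a b f f' g g' :
  laplacian VD f f' -> laplacian VD g g' ->
  laplacian VD (glin a f b g) (glin a f' b g').
Proof.
move=> [f2 f'2 [u [du [hu fu wu]]]] [g2 g'2 [v [dv [hv gv wv]]]].
split; [exact: L2_glin|exact: L2_glin|].
exists (glin a u b v), (glin a du b dv); split.
- exact: H10_glin.
- exact: gae_eq_glin.
- move=> w dw hw.
  have [? ?] := (H10_dL2 hu, H10_dL2 hv); have [? ?] := (H10_L2 hw, H10_dL2 hw).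
  rewrite !L2inner_glin//.
  by rewrite (wu _ _ hw) (wv _ _ hw) !mulrN opprD.
Qed.

(** The function f is itself an admissible test function, which gives
<g, f> = - |f'|^2. *)
Lemma laplacian_dissipative f g : laplacian VD f g -> L2inner g f <= 0.
Proof.
move=> [f2 g2 [u [du [hu fu wu]]]].
rewrite L2innerC (gae_L2inner f2 (H10_L2 hu) g2 fu) L2innerC.
by rewrite -oppr_ge0 -(wu _ _ hu) L2inner_ge0.
Qed.

End laplacian_theory.

(** * Uniqueness for the heat equation *)

(** Serves to pass to the limit in the triangle inequality, where k is the norm of
a combination of two functions and f and g are their norms. *)
Lemma squeeze_add_cvg0 (R : realType) (T : Type) (F : set_system T)
    (FF : Filter F) (f g k : T -> R) :
  (\forall x \near F, 0 <= k x <= f x + g x) ->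
  f x @[x --> F] --> (0 : R) -> g x @[x --> F] --> (0 : R) ->
  k x @[x --> F] --> (0 : R).
Proof.
move=> kfg f0 g0; apply: (@squeeze_cvgr _ _ _ _ (fun=> 0) (fun x => f x + g x)).
- exact: kfg.
- exact: cvg_cst.
- by have := @cvgD _ _ _ _ FF _ _ _ _ f0 g0; rewrite addr0.
Qed.

(** Only slopes to the right are controlled, so the mean value theorem does not
apply.  Instead, the last time before t at which F s <= eps * s can only be t
itself: the slope condition would extend the inequality beyond any earlier time. *)
Lemma nonpos_of_right_slope (R : realType) (F : R -> R) :
  (forall s : R, 0 <= s ->
    F r @[r --> within [set r | 0 <= r] (nbhs s)] --> F s) ->
  F 0 <= 0 ->
  (forall s : R, 0 <= s -> forall eps : R, 0 < eps ->
    \forall h \near (0 : R)^'+, F (s + h) <= F s + eps * h) ->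
  forall t : R, 0 <= t -> F t <= 0.
Proof.
move=> cF F0 dF t t0.
suff H (eps : R) : 0 < eps -> F t <= eps * t.
  have [->//|tn0] := eqVneq t 0.
  have tp : 0 < t by rewrite lt_def tn0.
  apply/ler_addgt0Pl => e e0; rewrite addr0.
  by have := H _ (divr_gt0 e0 tp); rewrite divfK.
move=> e0.
pose S := [set s | 0 <= s <= t /\ F s <= eps * s].
have S0 : S 0 by rewrite /S/= lexx t0 mulr0.
have Sub : has_ubound S by exists t => s [/andP[]].
have hS : has_sup S by split; [exists 0|].
have c0 : 0 <= sup S by exact: sup_ubound.
have ct : sup S <= t by apply: sup_le_ub; [exists 0|move=> s [/andP[]]].
have Fc : F (sup S) <= eps * sup S.
  rewrite leNgt; apply/negP => ltF.
  have : (fun r => F r - eps * r) r @[r --> within [set r | 0 <= r] (nbhs (sup S))]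
      --> F (sup S) - eps * sup S.
    apply: cvgB; first exact: cF.
    apply: cvgM; first exact: cvg_cst.
    by apply: cvg_within_filter; exact: cvg_id.
  have gap : 0 < F (sup S) - eps * sup S by rewrite subr_gt0.
  move=> hc; have {hc} : \forall r \near within [set r | 0 <= r] (nbhs (sup S)),
      0 < F r - eps * r by exact: cvgr_gt hc 0 gap.
  rewrite near_withinE => /nbhs_ballP[d /= d0 hd].
  have [r [/andP[r0 rt] Fr] cr] := sup_adherent d0 hS.
  have rc : r <= sup S by apply: sup_ubound => //; split => //; rewrite r0.
  have rd : ball (sup S) d r.
    by rewrite /ball/= ger0_norm ?subr_ge0// ltrBlDr -ltrBlDl.
  by have := hd r rd r0; rewrite subr_gt0 ltNge Fr.
have [->//|] := eqVneq t (sup S).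
move=> tc; have {}ct : sup S < t by rewrite lt_neqAle eq_sym tc.
have : exists h, [/\ 0 < h, h < t - sup S &
    F (sup S + h) <= F (sup S) + eps * h].
  near (0 : R)^'+ => h; exists h; split => //.
  - near: h; apply: nbhs_right_lt; rewrite subr_gt0//.
  - by near: h; apply: dF.
move=> [h [h0 ht Fh]].
have : sup S + h <= sup S.
  apply: sup_ubound => //; split.
    apply/andP; split; first exact: addr_ge0 c0 (ltW h0).
    by rewrite ltW// -ltrBrDl.
  by rewrite (le_trans Fh)// mulrDr lerD2r.
by rewrite gerDl leNgt h0.
Unshelve. all: by end_near. Qed.

Section heat_solutions.
Variables (R : realType) (G : metricGraph R) (VD : {set vertex G}).
Implicit Types (u v : R -> gfun G).

(** Solutions of the heat equation u' = Delta u in L^2.  The time derivative is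
taken from the right because the generator of a semigroup is a limit from the
right; continuity from the left does not follow from it and is required too. *)
Record heat_solution u u' : Prop := HeatSolution {
  heat_laplacian : forall s : R, 0 <= s -> laplacian VD (u s) (u' s);
  heat_continuous : forall s : R, 0 <= s ->
    L2norm (fun e x => u r e x - u s e x)
      @[r --> within [set r | 0 <= r] (nbhs s)] --> (0 : R);
  heat_derivative : forall s : R, 0 <= s ->
    L2norm (fun e x => h^-1 * (u (s + h) e x - u s e x) - u' s e x)
      @[h --> (0 : R)^'+] --> (0 : R) }.

Lemma heat_L2 u u' s : heat_solution u u' -> 0 <= s -> L2 (u s) /\ L2 (u' s).
Proof. by move=> hu s0; have [] := heat_laplacian hu s0. Qed.

Lemma glinB (f g : gfun G) : (fun e x => f e x - g e x) = glin 1 f (-1) g.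
Proof. by apply/funext => e; apply/funext => x; rewrite /glin mul1r mulN1r. Qed.

Lemma glin_diffquot (h : R) (f g k : gfun G) :
  (fun e x => h^-1 * (f e x - g e x) - k e x) =
  glin 1 (glin h^-1 f (- h^-1) g) (-1) k.
Proof.
by apply/funext => e; apply/funext => x; rewrite /glin; ring.
Qed.

Lemma L2normB_le (f g : gfun G) : L2 f -> L2 g ->
  `|L2norm f - L2norm g| <= L2norm (fun e x => f e x - g e x).
Proof.
move=> f2 g2; rewrite glinB; have d2 := L2_glin 1 (-1) f2 g2.
rewrite ler_norml; apply/andP; split.
- have : g = glin 1 f (-1) (glin 1 f (-1) g).
    by apply/funext => e; apply/funext => x; rewrite /glin; ring.
  move=> E; have := L2norm_glin_le 1 (-1) f2 d2.
  rewrite -E normrN normr1 !mul1r; lra.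
- have : f = glin 1 (glin 1 f (-1) g) 1 g.
    by apply/funext => e; apply/funext => x; rewrite /glin; ring.
  move=> E; have := L2norm_glin_le 1 1 d2 g2.
  rewrite -E normr1 !mul1r; lra.
Qed.

Lemma heat_solution_sub u u' v v' :
  heat_solution u u' -> heat_solution v v' ->
  heat_solution (fun s => glin 1 (u s) (-1) (v s))
                (fun s => glin 1 (u' s) (-1) (v' s)).
Proof.
move=> hu hv; split.
- move=> s s0; apply: laplacian_glin; [exact: heat_laplacian hu _ s0|
    exact: heat_laplacian hv _ s0].
- move=> s s0.
  apply: (@squeeze_add_cvg0 _ _ _ _
    (fun r => L2norm (fun e x => u r e x - u s e x))
    (fun r => L2norm (fun e x => v r e x - v s e x))).
  + near=> r; rewrite L2norm_ge0/=.
    have r0 : 0 <= r by near: r; exact: withinT.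
    have [us _] := heat_L2 hu s0; have [vs _] := heat_L2 hv s0.
    have [ur _] := heat_L2 hu r0; have [vr _] := heat_L2 hv r0.
    rewrite !glinB.
    have -> : glin 1 (glin 1 (u r) (-1) (v r)) (-1) (glin 1 (u s) (-1) (v s)) =
       glin 1 (glin 1 (u r) (-1) (u s)) (-1) (glin 1 (v r) (-1) (v s)).
      by apply/funext => e; apply/funext => x; rewrite /glin; ring.
    have := L2norm_glin_le 1 (-1) (L2_glin 1 (-1) ur us) (L2_glin 1 (-1) vr vs).
    by rewrite normrN normr1 !mul1r.
  + exact: heat_continuous hu _ s0.
  + exact: heat_continuous hv _ s0.
- move=> s s0.
  apply: (@squeeze_add_cvg0 _ _ _ _
    (fun h => L2norm (fun e x => h^-1 * (u (s + h) e x - u s e x) - u' s e x))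
    (fun h => L2norm (fun e x => h^-1 * (v (s + h) e x - v s e x) - v' s e x))).
  + near=> h; rewrite L2norm_ge0/=.
    have h0 : 0 <= s + h.
      by rewrite addr_ge0// ltW//; near: h; exact: nbhs_right_gt.
    have [us u's] := heat_L2 hu s0; have [vs v's] := heat_L2 hv s0.
    have [uh _] := heat_L2 hu h0; have [vh _] := heat_L2 hv h0.
    rewrite !glin_diffquot.
    set p := glin 1 (glin h^-1 (u _) _ _) _ _.
    set q := glin 1 (glin h^-1 (v _) _ _) _ _.
    have -> : glin 1 (glin h^-1 (glin 1 (u (s + h)) (-1) (v (s + h))) (- h^-1)
        (glin 1 (u s) (-1) (v s))) (-1) (glin 1 (u' s) (-1) (v' s)) =
       glin 1 p (-1) q.
      by apply/funext => e; apply/funext => x; rewrite /p /q /glin; ring.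
    have := @L2norm_glin_le _ _ 1 (-1) p q.
    rewrite normrN normr1 !mul1r; apply; do 2 apply: L2_glin => //.
  + exact: heat_derivative hu _ s0.
  + exact: heat_derivative hv _ s0.
Unshelve. all: by end_near. Qed.

(** The energy |u s|^2 is continuous and its right derivative is twice <u' s, u s>,
which is nonpositive by dissipativity. *)
Lemma heat_solution_eq0 u u' : heat_solution u u' -> L2norm (u 0) = 0 ->
  forall t : R, 0 <= t -> L2norm (u t) = 0.
Proof.
move=> hu u0 t t0.
have : L2norm (u t) ^+ 2 <= 0.
  move: t t0; apply: nonpos_of_right_slope.
  - move=> s s0; rewrite expr2.
    under eq_fun do rewrite expr2.
    suff : L2norm (u r) @[r --> within [set r | 0 <= r] (nbhs s)] --> L2norm (u s).
      by move=> h; apply: cvgM.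
    apply/subr_cvg0; apply: norm_cvg0.
    apply: (@squeeze_cvgr _ _ _ _ (fun=> 0)
      (fun r => L2norm (fun e x => u r e x - u s e x))).
    + near=> r; rewrite normr_ge0/=.
      have r0 : 0 <= r by near: r; exact: withinT.
      by apply: L2normB_le; [have [] := heat_L2 hu r0|have [] := heat_L2 hu s0].
    + exact: cvg_cst.
    + exact: heat_continuous hu _ s0.
  - by rewrite u0 expr0n.
  - move=> s s0 eps e0.
    have [us u's] := heat_L2 hu s0.
    pose k h : gfun G := fun e x => h^-1 * (u (s + h) e x - u s e x) - u' s e x.
    have : 2 * (L2norm (k h) * L2norm (u s)) +
        h * (L2norm (u' s) + L2norm (k h)) ^+ 2 @[h --> (0 : R)^'+] --> (0 : R).
      have kc : L2norm (k h) @[h --> (0 : R)^'+] --> (0 : R).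
        exact: heat_derivative hu _ s0.
      rewrite -[X in _ --> X](_ : 2 * (0 * L2norm (u s)) +
        0 * ((L2norm (u' s) + 0) * (L2norm (u' s) + 0)) = 0); last by ring.
      under eq_fun do rewrite expr2.
      apply: cvgD.
        apply: cvgM; first exact: cvg_cst.
        by apply: cvgM => //; exact: cvg_cst.
      have cc : L2norm (u' s) + L2norm (k h) @[h --> (0 : R)^'+] -->
          L2norm (u' s) + 0.
        by apply: cvgD => //; exact: cvg_cst.
      apply: cvgM; last exact: cvgM.
      by apply: cvg_within_filter; exact: cvg_id.
    move=> hc.
    have {hc} near_eps : \forall h \near (0 : R)^'+,
        2 * (L2norm (k h) * L2norm (u s)) +
        h * (L2norm (u' s) + L2norm (k h)) ^+ 2 < eps by exact: cvgr_lt hc eps e0.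
    near=> h.
    have h0 : 0 < h by near: h; exact: nbhs_right_gt.
    have [uh _] := heat_L2 hu (addr_ge0 s0 (ltW h0)).
    have kh : L2 (k h) by rewrite /k glin_diffquot; do 2 apply: L2_glin => //.
    (* with k h the error of the difference quotient, this expands |u (s + h)|^2
       to |u s|^2 + 2 h <u' s + k h, u s> + h^2 |u' s + k h|^2 *)
    have E : u (s + h) = glin 1 (u s) h (glin 1 (u' s) 1 (k h)).
      apply/funext => e; apply/funext => x; rewrite /glin /k.
      by field; rewrite gt_eqF.
    have w2 := L2_glin 1 1 u's kh.
    have diss := laplacian_dissipative (heat_laplacian hu s0).
    have := L2inner_CauchySchwarz kh us; rewrite ler_norml => /andP[_ CS].
    have := L2norm_glin_le 1 1 u's kh; rewrite normr1 !mul1r => tri.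
    have {}tri : L2norm (glin 1 (u' s) 1 (k h)) ^+ 2 <=
      (L2norm (u' s) + L2norm (k h)) ^+ 2.
      by rewrite ler_sqr ?nnegrE ?addr_ge0 ?L2norm_ge0.
    have slope : 2 * (L2norm (k h) * L2norm (u s)) +
        h * (L2norm (u' s) + L2norm (k h)) ^+ 2 < eps.
      by near: h.
    have wu : L2inner (glin 1 (u' s) 1 (k h)) (u s) =
        L2inner (u' s) (u s) + L2inner (k h) (u s).
      by rewrite L2inner_glin// !mul1r.
    move: E w2 tri wu; move: (glin 1 (u' s) 1 (k h)) => w E w2 tri wu.
    rewrite E [L2norm (glin _ _ _ _) ^+ 2]L2norm_sqr L2inner_glin//; last first.
      exact: L2_glin.
    rewrite !L2inner_glinr// (L2innerC (u s) w) -!L2norm_sqr.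
    rewrite wu; move: slope tri CS diss; move: (_ ^+ 2) => Q.
    move: (L2norm w ^+ 2) (L2norm (k h) * _) (L2inner (k h) _) (L2inner (u' s) _).
    move=> W K Y X slope tri CS diss.
    have := mulr_ge0 (ltW h0) (ltW (_ : 0 < eps - (2 * K + h * Q))).
    rewrite subr_gt0 => /(_ slope).
    have : 0 <= h * (K - Y) by rewrite mulr_ge0 ?subr_ge0// ltW.
    have : 0 <= h * - X by rewrite mulr_ge0 ?oppr_ge0// ltW.
    have : 0 <= h * (h * (Q - W)) by rewrite !mulr_ge0 ?subr_ge0// ltW.
    lra.
by move=> ut; apply/eqP; rewrite -sqrf_eq0 eq_le ut sqr_ge0.
Unshelve. all: by end_near. Qed.

(** The difference of the two solutions is a solution that starts at 0. *)
Lemma heat_solution_unique u u' v v' :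
  heat_solution u u' -> heat_solution v v' -> gae_eq (u 0) (v 0) ->
  forall t : R, 0 <= t -> gae_eq (u t) (v t).
Proof.
move=> hu hv uv t t0.
have [u2 _] := heat_L2 hu t0; have [v2 _] := heat_L2 hv t0.
have [u02 _] := heat_L2 hu (lexx 0); have [v02 _] := heat_L2 hv (lexx 0).
apply: gae_eq_of_L2norm => //; rewrite glinB.
apply: (heat_solution_eq0 (heat_solution_sub hu hv)) => //.
rewrite (@gae_L2norm _ _ _ (glin 1 (v 0) (-1) (v 0)));
  [|exact: L2_glin|exact: L2_glin|].
- rewrite -glinB -[RHS]sqrtr0; congr Num.sqrt.
  apply: big1 => e _; rewrite (_ : (fun x => _) = cst 0).
    by rewrite Rintegral_cst// mul0r.
  by apply/funext => x; rewrite subrr mul0r.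
- by apply: gae_eq_glin => // e; exact: aeW.
Qed.

End heat_solutions.

(** * Orbits of the heat semigroup *)

Section semigroup_orbits.
Variables (R : realType) (G : metricGraph R) (VD : {set vertex G}).
Variables (T : R -> gfun G -> gfun G) (hT : heat_semigroup VD T).
Implicit Types f g : gfun G.

(** By the semigroup law and linearity, the difference quotient of the orbit at time
s is the image under T s of the one at time 0.  The function k stands for either
T (s + h) f or T h (T s f), which are equal only almost everywhere. *)
Lemma diffquot_norm f g (s h : R) (k : gfun G) : 0 <= s -> 0 < h ->
  L2 f -> L2 g -> L2 k -> gae_eq k (T (s + h) f) ->
  L2norm (fun e x => h^-1 * (k e x - T s f e x) - T s g e x) =
  L2norm (T s (fun e x => h^-1 * (T h f e x - f e x) - g e x)).
Proof.
move=> s0 h0 f2 g2 k2 kT.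
have Tf2 := hs_L2 hT (ltW h0) f2.
set q : gfun G := fun e x => h^-1 * (T h f e x - f e x) - g e x.
have q2 : L2 q by rewrite /q glin_diffquot; do 2 apply: L2_glin => //.
have Tsq2 := hs_L2 hT s0 q2.
have [Tsf2 Tsg2] := (hs_L2 hT s0 f2, hs_L2 hT s0 g2).
apply: gae_L2norm => //.
  by rewrite glin_diffquot; do 2 apply: L2_glin => //.
have r2 : L2 (fun e x => h * g e x + f e x).
  have := L2_glin h 1 g2 f2; congr L2.
  by apply/funext => e; apply/funext => x; rewrite /glin mul1r.
(* h * q + (h * g + f) is T h f, so that linearity can be used on sums only *)
have E : T h f = (fun e x => h * q e x + (h * g e x + f e x)).
  apply/funext => e; apply/funext => x; rewrite /q.
  by field; rewrite gt_eqF.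
have l1 := hs_linear hT h s0 q2 r2; rewrite -E in l1.
have l2 := hs_linear hT h s0 g2 f2.
have l3 := hs_D hT s0 (ltW h0) f2.
have kE := gae_eq_trans (gae_eq_trans kT l3) l1.
move=> e; apply: ae_imply2 (kE e) (l2 e) => x a1 a2 Dx.
by rewrite a1// a2//; field; rewrite gt_eqF.
Qed.

Lemma diffquot_cvg f g (s : R) (k : R -> gfun G) : 0 <= s ->
  laplacian VD f g ->
  (forall h : R, 0 < h -> L2 (k h) /\ gae_eq (k h) (T (s + h) f)) ->
  L2norm (fun e x => h^-1 * (k h e x - T s f e x) - T s g e x)
    @[h --> (0 : R)^'+] --> (0 : R).
Proof.
move=> s0 fg hk; have [f2 g2 _] := fg.
have [C hC] := hs_bounded hT s0.
have q0 := (hs_generator hT f2 g2).1 fg.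
apply: (@squeeze_cvgr _ _ _ _ (fun=> 0)
  (fun h => C * L2norm (fun e x => h^-1 * (T h f e x - f e x) - g e x))).
- near=> h; rewrite L2norm_ge0/=.
  have h0 : 0 < h by near: h; exact: nbhs_right_gt.
  have [k2 kT] := hk h h0.
  rewrite (diffquot_norm s0 h0 f2 g2 k2 kT); apply: hC.
  have Tf2 := hs_L2 hT (ltW h0) f2.
  by rewrite glin_diffquot; do 2 apply: L2_glin => //.
- exact: cvg_cst.
- have := @cvgM _ _ _ _ _ _ C _ (cvg_cst C) q0; rewrite mulr0; exact.
Unshelve. all: by end_near. Qed.

(** The operator T s preserves the domain of the generator and commutes with it. *)
Lemma laplacian_orbit f g (s : R) : 0 <= s -> laplacian VD f g ->
  laplacian VD (T s f) (T s g).
Proof.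
move=> s0 fg; have [f2 g2 _] := fg.
have [Tf2 Tg2] := (hs_L2 hT s0 f2, hs_L2 hT s0 g2).
apply/(hs_generator hT) => //.
apply: (diffquot_cvg (k := fun h => T h (T s f))) => // h h0.
split; first exact: (hs_L2 hT (ltW h0) Tf2).
by rewrite addrC; apply: gae_eq_sym; exact: (hs_D hT (ltW h0) s0 f2).
Qed.

Lemma semigroup_orbit_solution f g : laplacian VD f g ->
  heat_solution VD (T^~ f) (T^~ g).
Proof.
move=> fg; have [f2 g2 _] := fg; split.
- by move=> s s0; exact: laplacian_orbit.
- by move=> s s0; exact: (hs_continuous hT f2 s0).
- move=> s s0; apply: (diffquot_cvg (k := fun h => T (s + h) f)) => // h h0.
  split; last by move=> e; exact: aeW.
  by apply: (hs_L2 hT _ f2); rewrite addr_ge0// ltW.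
Qed.

End semigroup_orbits.

(** * Lifting functions to the mirrored graph *)

Section lifting.
Variables (R : realType) (G : metricGraph R) (VD V0 : {set vertex G}) (m : nat).
Implicit Types f g u du : gfun G.
Local Notation GM := (mirror V0 m).
Local Notation VM := (mirror_set V0 m VD).

Definition mirror_lift f : gfun GM := fun e : edge G * 'I_m => f e.1.

Definition sheet (i : 'I_m) (v : gfun GM) : gfun G := fun e => v (e, i).

Lemma gint_sheets (F : gfun GM) : gint F = \sum_(i < m) gint (sheet i F).
Proof.
rewrite /gint exchange_big/= pair_bigA/=.
by apply: eq_bigr => -[e i] _.
Qed.

Lemma gint_lift f : gint (mirror_lift f) = m%:R * gint f.
Proof.
rewrite gint_sheets (eq_bigr (fun=> gint f))//.
by rewrite sumr_const card_ord mulr_natl.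
Qed.

(** The adjoint of the lift sums a function over the sheets. *)
Lemma L2inner_lift f (v : gfun GM) :
  L2inner (mirror_lift f) v = \sum_(i < m) L2inner f (sheet i v).
Proof. exact: gint_sheets. Qed.

Lemma L2norm_lift f : L2norm (mirror_lift f) = Num.sqrt m%:R * L2norm f.
Proof.
by rewrite -sqrtrM ?ler0n// -gint_lift.
Qed.

Lemma L2_lift f : L2 f -> L2 (mirror_lift f).
Proof. by move=> f2 e; exact: f2. Qed.

(** The folding map of the mirrored graph onto G, at the vertices. *)
Definition mirror_proj (z : mirror_vertex V0 m) : vertex G :=
  match z with inl v => sval v | inr v => sval v.1 end.

Lemma mirror_copyK (i : 'I_m) (v : vertex G) : mirror_proj (mirror_copy V0 i v) = v.
Proof.
rewrite /mirror_copy; move: (@boolP (v \in V0)) => vV0.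
(* the boolean that indexes vV0 also occurs in the types of the branches, hence
   the explicit return clause *)
exact: (match vV0 as d in alt_spec _ _ b
  return mirror_proj match d with
                     | AltTrue h => inl (exist _ v h)
                     | AltFalse h => inr (exist _ v h, i)
                     end = v
  with AltTrue _ => erefl | AltFalse _ => erefl end).
Qed.

(** The vertex values of the lift are those of u pulled back along the folding
map. *)
Lemma H10_lift u du : H10 VD u du -> H10 VM (mirror_lift u) (mirror_lift du).
Proof.
move=> [u2 du2 wu cu [c [c0 c1 cD]]]; split.
- exact: L2_lift.
- exact: L2_lift.
- by move=> e; exact: wu.
- by move=> e; exact: cu.
- exists (c \o mirror_proj); split.
  + by move=> e /=; rewrite mirror_copyK; exact: c0.
  + by move=> e /=; rewrite mirror_copyK; exact: c1.
  + by move=> z /imset2P[i v _ vD ->] /=; rewrite mirror_copyK cD.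
Qed.

(** The sheet i is a copy of G inside the mirrored graph, and it meets the Dirichlet
vertices in the copies of those of G.  The coupling with the other sheets at the
glued vertices is forgotten. *)
Lemma H10_sheet i (v dv : gfun GM) : H10 VM v dv ->
  H10 VD (sheet i v) (sheet i dv).
Proof.
move=> [v2 dv2 wv cv [c [c0 c1 cD]]]; split.
- by move=> e; exact: (v2 (e, i)).
- by move=> e; exact: (dv2 (e, i)).
- by move=> e; exact: (wv (e, i)).
- by move=> e; exact: (cv (e, i)).
- exists (fun v => c (mirror_copy V0 i v)); split.
  + by move=> e; exact: (c0 (e, i)).
  + by move=> e; exact: (c1 (e, i)).
  + by move=> z zD /=; apply: cD; apply/imset2P; exists i z.
Qed.

(** Against a test function v, the weak equation for the lift is the sum over the
sheets of the weak equations for f tested against the restrictions of v. *)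
Lemma laplacian_lift f g : laplacian VD f g ->
  laplacian VM (mirror_lift f) (mirror_lift g).
Proof.
move=> [f2 g2 [u [du [hu fu wu]]]]; split; [exact: L2_lift|exact: L2_lift|].
exists (mirror_lift u), (mirror_lift du); split.
- exact: H10_lift.
- by move=> e; exact: (fu e.1).
- move=> v dv hv; rewrite !L2inner_lift -sumrN.
  by apply: eq_bigr => i _; apply: wu; exact: H10_sheet.
Qed.

Lemma heat_solution_lift (u u' : R -> gfun G) : heat_solution VD u u' ->
  heat_solution VM (mirror_lift \o u) (mirror_lift \o u').
Proof.
have sqrt_cvg (F : set_system R) (FF : Filter F) (k : R -> gfun G) :
    L2norm (k r) @[r --> F] --> (0 : R) ->
    L2norm (mirror_lift (k r)) @[r --> F] --> (0 : R).
  move=> k0; under eq_fun do rewrite L2norm_lift.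
  have := @cvgM _ _ _ FF _ _ _ _ (cvg_cst (Num.sqrt m%:R)) k0.
  rewrite mulr0; exact.
move=> hu; split=> s s0.
- exact/laplacian_lift/(heat_laplacian hu).
- exact: (sqrt_cvg _ _ _ (heat_continuous hu s0)).
- exact: (sqrt_cvg _ _ _ (heat_derivative hu s0)).
Qed.

End lifting.

(** * Heat content as an integral of the orbit of 1 *)

Section kernel_content.
Variable R : realType.
Local Notation mu := (@lebesgue_measure R).

(** Tonelli's theorem gives measurability for nonnegative functions on the whole
plane; the general case follows by extending k by 0 and splitting it into its
positive and negative parts. *)
Lemma measurable_fun_Rintegral2 (D D' : set R) (k : R -> R -> R) :
  measurable D -> measurable D' ->
  measurable_fun (D `*` D') (fun z : R * R => k z.1 z.2) ->
  measurable_fun D (fun x => \int[mu]_(y in D') k x y).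
Proof.
move=> mD mD' mk.
pose f : measurableTypeR R * measurableTypeR R -> \bar R :=
  (fun z : R * R => (k z.1 z.2)%:E) \_ (D `*` D').
have mDD' : measurable (D `*` D') by exact: measurableX.
have mf : measurable_fun setT f.
  by apply/(@measurable_restrictT _ _ _ _ _ _ mDD'); exact/measurable_EFinP.
have mpos : measurable_fun setT (fubini_F mu f^\+%E).
  apply: measurable_fun_fubini_tonelli_F => //.
  exact: measurable_funepos.
have mneg : measurable_fun setT (fubini_F mu f^\-%E).
  apply: measurable_fun_fubini_tonelli_F => //.
  exact: measurable_funeneg.
have mfine : measurable_fun setT
    (fun x => fine (fubini_F mu f^\+%E x - fubini_F mu f^\-%E x)%E).
  apply: measurableT_comp => //; exact: emeasurable_funB.
apply: (@eq_measurable_fun _ _ _ _ _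
    (fun x => fine (fubini_F mu f^\+%E x - fubini_F mu f^\-%E x)%E)); last first.
  exact: measurable_funTS.
move=> x /set_mem Dx; rewrite /Rintegral; congr fine.
rewrite [RHS]integral_mkcond.
have fE y : f (x, y) = ((EFin \o k x) \_ D') y.
  by rewrite /f !patchE in_setX (mem_set Dx).
rewrite [RHS]integralE; congr (_ - _)%E; apply: eq_integral => y _.
  by rewrite !funeposE fE.
by rewrite !funenegE fE.
Qed.

Variable G : metricGraph R.

Lemma L2_cst (c : R) : L2 (fun (_ : edge G) _ => c).
Proof.
move=> e; apply: square_integrable_continuous.
by apply: continuous_subspaceT => x; exact: cvg_cst.
Qed.

Lemma gae_gint (f g : gfun G) :
  (forall e, measurable_fun `]0, len e[%classic (f e)) ->
  (forall e, measurable_fun `]0, len e[%classic (g e)) ->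
  gae_eq f g -> gint f = gint g.
Proof.
by move=> mf mg fg; apply: eq_bigr => e _; exact: Rintegral_ae_eq.
Qed.

(** Integrating the kernel in its second variable applies S to the function 1, but
only for almost every x; measurability of the inner integral is what allows the
outer integrals to be compared. *)
Lemma heat_content_gint (p : R -> edge G -> R -> edge G -> R -> R) (t : R)
    (S : gfun G -> gfun G) :
  integral_kernel S (p t) -> L2 (S (fun _ _ => 1)) ->
  heat_content p t = gint (S (fun _ _ => 1)).
Proof.
move=> [mp Sp] S2; apply: gae_gint => [e|e|e].
- apply: measurable_sum => e'.
  apply: measurable_fun_Rintegral2 => //; exact: mp.
- exact: L2_measurable.
- apply: ae_imply1 (Sp _ (L2_cst 1) e) => x h Dx.
  have [_ ->] := h Dx.
  by apply: eq_bigr => e' _; apply: eq_Rintegral => y _; rewrite mulr1.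
Qed.

End kernel_content.

(** * Twice continuously differentiable functions *)

Section twice_differentiable.
Variable R : realType.
Implicit Types f g : R -> R.

(** A second order error estimate for the increments determines the derivative. *)
Lemma is_derive_quadratic f (x d K : R) :
  (forall h, `|h| <= 1 -> `|f (x + h) - f x - h * d| <= K * h ^+ 2) ->
  is_derive x 1 f d.
Proof.
move=> fK.
have c : h^-1 *: ((f \o shift x) (h *: 1) - f x) @[h --> (0 : R)^'] --> d.
  apply/subr_cvg0; apply: norm_cvg0.
  apply: (@squeeze_cvgr _ _ _ _ (fun=> 0) (fun h => K * `|h|)).
  - near=> h; rewrite normr_ge0/=.
    have h0 : h != 0 by near: h; exact: nbhs_dnbhs_neq.
    have h1 : `|h| <= 1.
      near: h; apply: cvg_within; exists 1 => //= y.
      by rewrite /ball_/= sub0r normrN => /ltW.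
    have -> : h^-1 *: ((f \o shift x) (h *: 1) - f x) - d =
        h^-1 * (f (x + h) - f x - h * d).
      by rewrite /= scaler1 (addrC h x) /GRing.scale/=; field.
    rewrite normrM normfV ler_pdivrMl ?normr_gt0//.
    apply: le_trans (fK h h1) _.
    by rewrite -[h ^+ 2]ger0_norm ?sqr_ge0// normrX expr2 mulrCA.
  - exact: cvg_cst.
  - rewrite -[X in _ --> X](mulr0 K); apply: cvgM; first exact: cvg_cst.
    rewrite -[X in _ --> X](normr0 R); apply: cvg_norm.
    by apply: cvg_within_filter; exact: cvg_id.
apply: DeriveDef; first by apply/cvg_ex; exists d.
exact: cvg_lim c.
Unshelve. all: by end_near. Qed.

(** The derivatives are part of the data, so that the closure properties below
compute them. *)
Definition C2 f f1 f2 : Prop :=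
  [/\ forall x : R, is_derive x 1 f (f1 x), forall x : R, is_derive x 1 f1 (f2 x) &
      continuous f2].

Lemma C2_derive1 f f1 f2 : C2 f f1 f2 -> C2 f (derive1 f) (derive1 (derive1 f)).
Proof.
move=> [df df1 cf2].
have E1 : derive1 f = f1 by apply/funext => x; rewrite derive1E; case: (df x).
have E2 : derive1 f1 = f2 by apply/funext => x; rewrite derive1E; case: (df1 x).
by rewrite E1 E2.
Qed.

Lemma is_derive_continuous f f1 : (forall x : R, is_derive x 1 f (f1 x)) ->
  continuous f.
Proof.
move=> df x; apply: differentiable_continuous; apply/derivable1_diffP.
by case: (df x).
Qed.

Lemma C2_comp f f1 f2 g g1 g2 : C2 f f1 f2 -> C2 g g1 g2 ->
  C2 (f \o g) (fun x => f1 (g x) * g1 x)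
     (fun x => f2 (g x) * g1 x * g1 x + f1 (g x) * g2 x).
Proof.
move=> [df df1 cf2] [dg dg1 cg2]; split.
- by move=> x; apply: is_derive1_comp.
- move=> x; have h := is_deriveM (is_derive1_comp (df1 (g x)) (dg x)) (dg1 x).
  apply: (is_derive_eq h).
  rewrite /GRing.scale/=; ring.
- have cg := is_derive_continuous dg; have cg1 := is_derive_continuous dg1.
  have cf1 := is_derive_continuous df1.
  move=> x; apply: cvgD; last first.
    by apply: cvgM; [apply: (continuous_comp (cg x)); exact: cf1|exact: cg2].
  apply: cvgM; last exact: cg1.
  by apply: cvgM; [apply: (continuous_comp (cg x)); exact: cf2|exact: cg1].
Qed.

Lemma C2_quadratic (a b c : R) :
  C2 (fun x => a + b * x + c * x ^+ 2) (fun x => b + 2 * c * x) (fun=> 2 * c).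
Proof.
split; last by move=> x; exact: cvg_cst.
- move=> x; apply: (@is_derive_quadratic _ _ _ `|c|) => h _.
  have -> : a + b * (x + h) + c * (x + h) ^+ 2 - (a + b * x + c * x ^+ 2) -
    h * (b + 2 * c * x) = c * h ^+ 2 by ring.
  by rewrite normrM normrX real_normK ?num_real.
- move=> x; apply: (@is_derive_quadratic _ _ _ 0) => h _.
  have -> : b + 2 * c * (x + h) - (b + 2 * c * x) - h * (2 * c) = 0 by ring.
  by rewrite normr0 mul0r.
Qed.

(** The third power is the first one for which the positive part becomes twice
continuously differentiable. *)
Definition ramp3 (s : R) : R := Num.max s 0 ^+ 3.

Lemma C2_ramp3 :
  C2 ramp3 (fun s => 3 * Num.max s 0 ^+ 2) (fun s => 6 * Num.max s 0).
Proof.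
split.
- move=> s; apply: (@is_derive_quadratic _ _ _ (3 * `|s| + 1)) => h h1.
  rewrite /ramp3 ler_norml; move: h1; rewrite ler_norml => /andP[h1 h2].
  have hh : 0 <= h ^+ 2 := sqr_ge0 h.
  have hp : 0 <= h ^+ 2 * (1 - h) by rewrite mulr_ge0// subr_ge0.
  have hm : 0 <= h ^+ 2 * (1 + h) by rewrite mulr_ge0//; lra.
  have shh : 0 <= `|s| * h ^+ 2 by rewrite mulr_ge0.
  rewrite /Num.max; case: (ltP (s + h) 0) => y0; case: (ltP s 0) => s0 /=.
  + by apply/andP; split; lra.
  + rewrite (ger0_norm s0) in shh *.
    have a : 0 <= s * (- h) * (- h - s) by rewrite !mulr_ge0//; lra.
    have b : 0 <= s * s * (- s - 3 * h) by rewrite !mulr_ge0//; lra.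
    have c : 0 <= s * s * s by rewrite !mulr_ge0.
    by apply/andP; split; lra.
  + have a : 0 <= (s + h) ^+ 3 by rewrite exprn_ge0.
    have b : (s + h) ^+ 2 <= h ^+ 2 by rewrite ler_sqr ?nnegrE; lra.
    have c : 0 <= (s + h) ^+ 2 * (1 - (s + h)).
      by rewrite mulr_ge0 ?sqr_ge0//; lra.
    by apply/andP; split; lra.
  + rewrite (ger0_norm s0) in shh *.
    by apply/andP; split; lra.
- move=> s; apply: (@is_derive_quadratic _ _ _ 3) => h _; rewrite ler_norml.
  have hh : 0 <= h ^+ 2 := sqr_ge0 h.
  rewrite /Num.max; case: (ltP (s + h) 0) => y0; case: (ltP s 0) => s0 /=.
  + by apply/andP; split; lra.
  + have a : 0 <= s * (- h - s) by rewrite mulr_ge0//; lra.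
    have b : 0 <= (- h - s) * (- h - s) by rewrite mulr_ge0//; lra.
    have c : 0 <= s * s by rewrite mulr_ge0.
    by apply/andP; split; lra.
  + have b : (s + h) ^+ 2 <= h ^+ 2 by rewrite ler_sqr ?nnegrE; lra.
    have c : 0 <= (s + h) ^+ 2 by exact: sqr_ge0.
    by apply/andP; split; lra.
  + by apply/andP; split; lra.
- move=> s; apply: cvgM; first exact: cvg_cst.
  by apply: (@continuous_max R R id (fun=> 0)) => //; exact: cvg_cst.
Qed.

End twice_differentiable.

(** * Functions supported away from the vertices *)

Section compact_support.
Variable R : realType.
Local Notation mu := (@lebesgue_measure R).

Lemma is_derive_LRcontinuous (f f1 : R -> R) (a b : R) :
  (forall x : R, is_derive x 1 f (f1 x)) -> derivable_oo_LRcontinuous f a b.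
Proof.
move=> df; have cf := is_derive_continuous df; split.
- by move=> x _; case: (df x).
- exact: cvg_at_right_filter (cf a).
- exact: cvg_at_left_filter (cf b).
Qed.

Lemma Rintegral_oo_cc (l : R) (w : R -> R) : {within `[0, l], continuous w} ->
  \int[mu]_(x in `]0, l[) w x = fine (\int[mu]_(x in `[0%R, l]) (w x)%:E)%E.
Proof.
move=> cw; rewrite /Rintegral; congr fine.
apply/esym/integral_itv_bndoo/measurable_EFinP.
apply: measurable_funS (subspace_continuous_measurable_fun _ cw) => //.
by apply: subset_itv; rewrite bnd_simp.
Qed.

(** Integration by parts, without boundary terms since f vanishes at both ends. *)
Lemma weak_derivative_C1 (l : R) (f f1 : R -> R) : 0 < l ->
  (forall x : R, is_derive x 1 f (f1 x)) -> continuous f1 ->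
  f 0 = 0 -> f l = 0 -> weak_derivative l f f1.
Proof.
move=> l0 df cf1 f0 fl phi [dphi cphi _].
have dphi' (x : R) : is_derive x 1 phi (derive1 phi x).
  by rewrite derive1E; exact/derivableP.
have [cf cp] := (is_derive_continuous df, is_derive_continuous dphi').
have cM (p q : R -> R) : continuous p -> continuous q ->
    {within `[0, l], continuous (fun x => p x * q x)}.
  move=> pc qc; apply: continuous_subspaceT => x.
  by apply: cvgM; [exact: pc|exact: qc].
rewrite !Rintegral_oo_cc; try exact: cM.
rewrite (@integration_by_parts _ f phi f1 (derive1 phi))//.
- rewrite f0 fl !mul0r subrr add0e fineN//.
- exact: continuous_subspaceT.
- exact: is_derive_LRcontinuous df.
- by move=> x _; rewrite derive1E; case: (df x).
- exact: continuous_subspaceT.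
- exact: is_derive_LRcontinuous dphi'.
Qed.

Variables (G : metricGraph R) (VD : {set vertex G}).

Definition supported_in (a b : R) (f : R -> R) : Prop :=
  forall x, ~~ (a <= x <= b) -> f x = 0.

(** Outside [a, b], which is closed, f vanishes on a neighbourhood. *)
Lemma supported_in_derive (a b : R) (f f1 : R -> R) :
  (forall x : R, is_derive x 1 f (f1 x)) ->
  supported_in a b f -> supported_in a b f1.
Proof.
move=> df sf x xab.
have near0 : \near x, f x = cst 0 x.
  have : nbhs x (~` `[a, b]%classic).
    apply: open_nbhs_nbhs; split; first exact/closed_openC/itv_closed.
    by move=> /=; rewrite in_itv/=; exact/negP.
  by apply: filterS => y /= /negP; rewrite in_itv/=; exact: sf.
have h : is_derive x 1 (cst 0) (f1 x) := near_eq_is_derive near0 (df x).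
by rewrite -(@derive_val _ _ _ _ _ _ _ h) derive_cst.
Qed.

(** Since f1 vanishes near the ends of every edge, it is an admissible test function
in the definition of the weak derivative of any v in H^1.  This is the weak
equation <f1, v'> = - <f2, v>, edge by edge, so the vertex conditions do not
enter. *)
Lemma laplacian_C2 (f f1 f2 : gfun G) :
  (forall e, C2 (f e) (f1 e) (f2 e)) ->
  (forall e, exists a b : R, [/\ 0 < a, b < len e & supported_in a b (f e)]) ->
  laplacian VD f f2.
Proof.
move=> fC2 fsupp.
have L2c (g : gfun G) : (forall e, continuous (g e)) -> L2 g.
  by move=> cg e; apply: square_integrable_continuous; exact: continuous_subspaceT.
have cf e : continuous (f e) by have [/is_derive_continuous] := fC2 e.
have cf1 e : continuous (f1 e) by have [_ /is_derive_continuous] := fC2 e.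
have cf2 e : continuous (f2 e) by have [] := fC2 e.
have f0 e : f e 0 = 0.
  by have [a [b [a0 _ ->//]]] := fsupp e; rewrite leNgt a0.
have fl e : f e (len e) = 0.
  by have [a [b [_ bl ->//]]] := fsupp e; rewrite negb_and -!ltNge bl orbT.
have df1E e : derive1 (f1 e) = f2 e.
  have [_ df1 _] := fC2 e.
  by apply/funext => x; rewrite derive1E; case: (df1 x).
have tf1 e : test_function (len e) (f1 e).
  have [df df1 _] := fC2 e; split.
  - by move=> x; case: (df1 x).
  - by rewrite df1E.
  - have [a [b [a0 bl sf]]] := fsupp e.
    have sf1 := supported_in_derive df sf.
    apply: (@subset_trans _ `[a, b]%classic).
      have -> : `[a, b]%classic = closure `[a, b]%classic.
        by apply/closure_id; exact: itv_closed.
      apply: closureS => x /=; rewrite in_itv/=.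
      by apply: contraNT => /sf1 ->.
    by apply: subset_itv; rewrite bnd_simp.
split; [exact: L2c|exact: L2c|].
exists f, f1; split.
- split; [exact: L2c|exact: L2c| | |].
  + move=> e; have [df df1 _] := fC2 e.
    exact: (weak_derivative_C1 (len_gt0 e) df (cf1 e) (f0 e) (fl e)).
  + by move=> e; exact: continuous_subspaceT.
  + by exists (fun=> 0).
- by move=> e; exact: aeW.
- move=> v dv hv; rewrite /L2inner /gint -sumrN; apply: eq_bigr => e _.
  have := H10_weak hv (tf1 e); rewrite df1E => /(congr1 -%R); rewrite opprK.
  move=> h; rewrite [LHS](_ : _ = \int[mu]_(x in `]0, len e[) (dv e x * f1 e x)).
    rewrite -h; congr (- _); apply: eq_Rintegral => x _; exact: mulrC.
  by apply: eq_Rintegral => x _; exact: mulrC.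
Qed.

End compact_support.

(** * Cutoff functions converging to 1 *)

Section cutoff.
Variable R : realType.
Local Notation mu := (@lebesgue_measure R).

Lemma ramp3_eq0 (s : R) : s <= 0 -> ramp3 s = 0.
Proof. by move=> s0; rewrite /ramp3 max_r// expr0n. Qed.

Lemma ramp3_ge0 (s : R) : 0 <= ramp3 s.
Proof. by rewrite /ramp3 exprn_ge0// le_max lexx orbT. Qed.

Lemma ramp3_ge1 (s : R) : 1 <= s -> 1 <= ramp3 s.
Proof.
move=> s1; rewrite /ramp3 exprn_ege1// le_max s1//.
Qed.

Lemma ramp3_le1 (s : R) : s <= 1 -> ramp3 s <= 1.
Proof.
move=> s1; rewrite /ramp3 exprn_ile1// ?le_max ?lexx ?orbT//.
by rewrite ge_max s1 ler01.
Qed.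

(** The polynomial x * (l - x) vanishes exactly at the two ends of the edge.  The
cutoff is 0 where n.+1 times it is at most 1, and 1 where it is at least 2. *)
Definition cutoff (l : R) (n : nat) (x : R) : R :=
  ramp3 (1 - ramp3 (2 - n.+1%:R * (x * (l - x)))).

Lemma C2_cutoff (l : R) (n : nat) :
  C2 (cutoff l n) (derive1 (cutoff l n)) (derive1 (derive1 (cutoff l n))).
Proof.
have h := C2_comp (C2_ramp3 R) (C2_comp (C2_quadratic 1 (-1) 0)
  (C2_comp (C2_ramp3 R) (C2_quadratic 2 (- (n.+1%:R * l)) n.+1%:R))).
suff -> : cutoff l n = ramp3 (R := R) \o ((fun x => 1 + -1 * x + 0 * x ^+ 2) \o
  (ramp3 (R := R) \o (fun x => 2 + - (n.+1%:R * l) * x + n.+1%:R * x ^+ 2))).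
  exact: C2_derive1 h.
apply/funext => x; rewrite /cutoff /=; congr ramp3.
by rewrite mul0r addr0 mulN1r; congr (1 - ramp3 _); ring.
Qed.

Lemma cutoff_ge0 l n x : 0 <= cutoff l n x.
Proof. exact: ramp3_ge0. Qed.

Lemma cutoff_le1 l n x : cutoff l n x <= 1.
Proof. by apply: ramp3_le1; rewrite gerBl ramp3_ge0. Qed.

Lemma cutoff_eq1 l n x : 2 <= n.+1%:R * (x * (l - x)) -> cutoff l n x = 1.
Proof.
move=> h; rewrite /cutoff (@ramp3_eq0 (2 - _)) ?subr_le0//.
by rewrite subr0 /ramp3 max_l ?ler01// expr1n.
Qed.

Lemma cutoff_supported (l : R) n : 0 < l ->
  exists a b : R, [/\ 0 < a, b < l & supported_in a b (cutoff l n)].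
Proof.
move=> l0; pose a := (n.+1%:R * l)^-1.
have N0 : 0 < n.+1%:R :> R by rewrite ltr0n.
have Nl0 : 0 < n.+1%:R * l by rewrite mulr_gt0.
have a0 : 0 < a by rewrite invr_gt0.
have aE : n.+1%:R * l * a = 1 by rewrite divff// gt_eqF.
exists a, (l - a); split => //; first by rewrite gtrBl.
move=> x; rewrite negb_and -!ltNge => xa.
apply: ramp3_eq0; rewrite subr_le0; apply: ramp3_ge1.
suff : n.+1%:R * (x * (l - x)) <= 1 by lra.
have [x0|x0] := leP x 0.
  apply: le_trans ler01; rewrite pmulr_rle0//.
  by apply: mulr_le0_ge0 => //; lra.
have [xl|xl] := leP l x.
  apply: le_trans ler01; rewrite pmulr_rle0//.
  by apply: mulr_ge0_le0; lra.
(* x * (l - x) is at most l times the distance of x to either end, and this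
   distance is less than a at one of them *)
case/orP: xa => xa.
  rewrite -[leRHS]aE -mulrA ler_pM2l//.
  have := mulr_ge0 (ltW x0) (ltW x0).
  have : 0 <= l * (a - x) by rewrite mulr_ge0 ?ltW// subr_gt0.
  lra.
rewrite -[leRHS]aE -mulrA ler_pM2l//.
have : 0 <= (l - x) * (l - x) by rewrite mulr_ge0// subr_ge0 ltW.
have : 0 <= l * (a - (l - x)) by rewrite mulr_ge0 ?ltW//; lra.
lra.
Qed.

Lemma cutoff_cvg (l x : R) : 0 < x < l -> cutoff l n x @[n --> \oo] --> (1 : R).
Proof.
move=> /andP[x0 xl]; apply: cvg_near_cst.
have c0 : 0 < x * (l - x) by rewrite mulr_gt0// subr_gt0.
near=> n; apply: cutoff_eq1; rewrite -ler_pdivrMr//.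
apply: (@le_trans _ _ n%:R); last by rewrite ler_nat.
near: n; exact: nbhs_infty_ger.
Unshelve. all: by end_near. Qed.

(** Dominated convergence with the bound 1. *)
Lemma cutoff_L2_cvg (l : R) :
  \int[mu]_(x in `]0, l[) ((1 - cutoff l n x) * (1 - cutoff l n x))
    @[n --> \oo] --> (0 : R).
Proof.
pose F n x := ((1 - cutoff l n x) * (1 - cutoff l n x))%:E.
have mcut n : measurable_fun `]0, l[ (cutoff l n).
  have [df _ _] := C2_cutoff l n.
  apply: measurable_funTS; apply: continuous_measurable_fun.
  exact: is_derive_continuous df.
have F0 : (\int[mu]_(x in `]0%R, l[) F n x)%E @[n --> \oo] --> 0%E.
  rewrite -[X in _ --> X](@integral0 _ _ _ mu `]0, l[%classic).
  apply: (@dominated_cvg _ _ _ mu _ _ F (cst 0%E) (cst 1%E)) => //.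
  - move=> n; apply/measurable_EFinP; apply: measurable_funM;
      by apply: measurable_funB => //; exact: mcut.
  - move=> x x0l; have {x0l} : x \in `]0, l[%R by exact: x0l.
    rewrite in_itv/= => x0l; apply: cvg_EFin; first exact: nearW.
    rewrite [X in _ --> X](_ : _ = (1 - 1) * (1 - 1)); last by rewrite subrr mulr0.
    by apply: cvgM; apply: cvgB; [exact: cvg_cst|exact: cutoff_cvg|
      exact: cvg_cst|exact: cutoff_cvg].
  - apply: measurable_bounded_integrable => //; last exact: bounded_cst.
    by rewrite /= lebesgue_measure_itv/=; case: ifPn => // _; rewrite -EFinB ltry.
  - move=> n x _; rewrite /F abse_EFin lee_fin.
    have := cutoff_ge0 l n x; have := cutoff_le1 l n x => c1 c0.
    by rewrite normrM mulr_ile1 ?normr_ge0// ger0_norm ?subr_ge0// gerBl.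
exact: (fine_cvg F0).
Qed.

End cutoff.

Section density.
Variables (R : realType) (G : metricGraph R) (VD : {set vertex G}).

Definition gcutoff (n : nat) : gfun G := fun e => cutoff (len e) n.

Lemma laplacian_gcutoff n : exists g, laplacian VD (gcutoff n) g.
Proof.
exists (fun e => derive1 (derive1 (cutoff (len e) n))).
apply: (@laplacian_C2 _ _ _ _ (fun e => derive1 (cutoff (len e) n))).
- by move=> e; exact: C2_cutoff.
- by move=> e; exact/cutoff_supported/len_gt0.
Qed.

Lemma gcutoff_cvg :
  L2norm (fun e x => 1 - gcutoff n e x) @[n --> \oo] --> (0 : R).
Proof.
rewrite /L2norm -[X in _ --> X]sqrtr0.
apply: (continuous_cvg _ (@sqrt_continuous R 0)).
rewrite /L2inner /gint.
rewrite [X in _ --> X](_ : _ = \sum_(e : edge G) 0); last by rewrite big1.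
apply: cvg_big => [|e _]; first exact: add_continuous.
exact: cutoff_L2_cvg.
Qed.

End density.

(** * The lift intertwines the heat semigroups *)

Section heat_flow_lift.
Variables (R : realType) (G : metricGraph R) (VD V0 : {set vertex G}) (m : nat).
Local Notation GM := (mirror V0 m).
Local Notation VM := (mirror_set V0 m VD).
Variables (T : R -> gfun G -> gfun G) (hT : heat_semigroup VD T).
Variables (TM : R -> gfun GM -> gfun GM) (hTM : heat_semigroup VM TM).

(** Both sides solve the heat equation on the mirrored graph with initial value the
lift of f. *)
Lemma heat_semigroup_lift_domain f g (t : R) : 0 <= t -> laplacian VD f g ->
  gae_eq (TM t (mirror_lift f)) (mirror_lift (T t f)).
Proof.
move=> t0 fg; have [f2 _ _] := fg.
apply: (heat_solution_unique
  (semigroup_orbit_solution hTM (laplacian_lift V0 m fg))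
  (heat_solution_lift V0 m (semigroup_orbit_solution hT fg))) => //=.
apply: (gae_eq_trans (hs_0 hTM (@L2_lift _ _ V0 m _ f2))).
by apply: gae_eq_sym => e; exact: (hs_0 hT f2 e.1).
Qed.

Lemma semigroup_sub (G' : metricGraph R) (W : {set vertex G'})
    (S : R -> gfun G' -> gfun G') f g (t : R) : heat_semigroup W S -> 0 <= t ->
  L2 f -> L2 g ->
  gae_eq (S t (fun e x => f e x - g e x)) (fun e x => S t f e x - S t g e x).
Proof.
move=> hS t0 f2 g2 e; apply: ae_imply1 (hs_linear hS (-1) t0 g2 f2 e) => x h Dx.
rewrite [X in S t X](_ : _ = fun e x => -1 * g e x + f e x).
  by rewrite h// mulN1r addrC.
by apply/funext => e'; apply/funext => y; rewrite mulN1r addrC.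
Qed.

(** Both sides depend continuously on f in L^2, so the identity extends from the
domain of the Laplacian to its limits. *)
Lemma heat_semigroup_lift (t : R) (f : gfun G) (fn : nat -> gfun G) :
  0 <= t -> L2 f ->
  (forall n, exists g, laplacian VD (fn n) g) ->
  L2norm (fun e x => f e x - fn n e x) @[n --> \oo] --> (0 : R) ->
  gae_eq (TM t (mirror_lift f)) (mirror_lift (T t f)).
Proof.
move=> t0 f2 hfn fnf.
have Tf2 := hs_L2 hT t0 f2; have lf2 := @L2_lift _ _ V0 m _ f2.
have TMf2 := hs_L2 hTM t0 lf2.
apply: gae_eq_of_L2norm => //; first exact: L2_lift.
have [C hC] := hs_bounded hT t0; have [CM hCM] := hs_bounded hTM t0.
pose K := CM * Num.sqrt m%:R + Num.sqrt m%:R * C.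
apply/eqP; rewrite eq_le L2norm_ge0 andbT.
have K0 : K * L2norm (fun e x => f e x - fn n e x) @[n --> \oo] --> (0 : R).
  have := @cvgM _ _ _ _ _ _ _ _ (cvg_cst K) fnf.
  rewrite mulr0; exact.
apply: (cvgr_to_ge K0); apply: nearW => n.
have [g fng] := hfn n; have [fn2 g2 _] := fng.
pose d : gfun G := fun e x => f e x - fn n e x.
have d2 : L2 d by rewrite /d glinB; exact: L2_glin.
have ld2 := @L2_lift _ _ V0 m _ d2.
have [Td2 TMd2] := (hs_L2 hT t0 d2, hs_L2 hTM t0 ld2).
have lTd2 := @L2_lift _ _ V0 m _ Td2; have lTf2 := @L2_lift _ _ V0 m _ Tf2.
have e1 : gae_eq (mirror_lift (T t d))
    (mirror_lift (fun e x => T t f e x - T t (fn n) e x) : gfun GM).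
  by move=> e; exact: (semigroup_sub hT t0 f2 fn2 e.1).
have e2 := semigroup_sub hTM t0 lf2 (@L2_lift _ _ V0 m _ fn2).
have e3 := heat_semigroup_lift_domain t0 fng.
have e4 := gae_eq_glin 1 (-1) e2 e1.
have -> : L2norm (fun e x => TM t (mirror_lift f) e x - mirror_lift (T t f) e x) =
    L2norm (glin 1 (TM t (mirror_lift d)) (-1) (mirror_lift (T t d))).
  apply: gae_L2norm; [by rewrite glinB; exact: L2_glin|exact: L2_glin|].
  move=> e; apply: ae_imply2 (e3 e) (e4 e) => x a b Dx.
  rewrite b// /glin a// /mirror_lift; ring.
apply: le_trans (L2norm_glin_le _ _ TMd2 lTd2) _.
rewrite normrN normr1 !mul1r /K mulrDl L2norm_lift -!mulrA.
apply: lerD; first by rewrite -(L2norm_lift V0); exact: hCM.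
by rewrite ler_wpM2l ?sqrtr_ge0//; exact: hC.
Qed.

End heat_flow_lift.

Theorem theorem6p8 (R : realType) (G : metricGraph R) (VD : {set vertex G})
    (hG : standing_assumption VD)
    (V0 : {set vertex G}) (hV0 : (V0 \subset ~: VD)%SET)
    (m : nat) (hm : (0 < m)%N)
    (p : R -> edge G -> R -> edge G -> R -> R)
    (hp : heat_kernel VD p)
    (pm : R -> edge (mirror V0 m) -> R -> edge (mirror V0 m) -> R -> R)
    (hpm : heat_kernel (mirror_set V0 m VD) pm)
    (t : R) (ht : 0 < t) :
  heat_content pm t = m%:R * heat_content p t.
Proof.
have [T hT Tp] := hp; have [TM hTM TMp] := hpm.
have t0 := ltW ht.
have one2 := @L2_cst R G 1; have oneM2 := @L2_cst R (mirror V0 m) 1.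
have T2 := hs_L2 hT t0 one2; have TM2 := hs_L2 hTM t0 oneM2.
rewrite (heat_content_gint (Tp t ht) T2) (heat_content_gint (TMp t ht) TM2).
rewrite -(gint_lift V0); apply: gae_gint => [e|e|].
- exact: L2_measurable.
- by apply: L2_measurable; exact: L2_lift.
- have dense1 := laplacian_gcutoff VD.
  exact: (heat_semigroup_lift hT hTM t0 one2 dense1 (@gcutoff_cvg R G)).
Qed.
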